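(* Let $\Gamma_1,\ldots,\Gamma_n$ be diagrams in $\mathbb{R}^n$. (1) $[\Gamma_1,\ldots,\Gamma_n]_0=0$ if and only if $0\in\Gamma_i$ for some $i$, $1\le i\le n$. (2) Assume $[\Gamma_1,\ldots,\Gamma_n]_0\ne0$. Then $[\Gamma_1,\ldots,\Gamma_n]_0<\infty$ if and only if for all $I\subseteq[n]$, $|\{j\in[n]:\Gamma_j\cap\mathbb{R}^I\ne\emptyset\}|\ge|I|$.
   Context: $\mathbb{K}$ is an algebraically closed field of arbitrary characteristic, $n\ge1$, $[n]=\{1,\ldots,n\}$. The Newton polytope of a polynomial is the convex hull of its support; its Newton diagram is the union of the compact faces of $(\mathbb{R}_{\ge0})^n+(\text{Newton polytope})$. A diagram in $\mathbb{R}^n$ is the Newton diagram of some polynomial in $\mathbb{K}[x_1,\ldots,x_n]$. $\mathbb{R}^I=\{x\in\mathbb{R}^n:x_i=0\text{ for }i\notin I\}$. For polynomials, $[f_1,\ldots,f_n]_0=\dim_{\mathbb{K}}\mathbb{K}[[x_1,\ldots,x_n]]/\langle f_1,\ldots,f_n\rangle$; for diagrams, $[\Gamma_1,\ldots,\Gamma_n]_0$ is the minimum of $[f_1,\ldots,f_n]_0$ over all polynomials $f_1,\ldots,f_n$ with Newton diagrams $\Gamma_1,\ldots,\Gamma_n$ respectively (so it lies in $\{0,1,\ldots,\infty\}$). *)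

(* Defs.v *)
From HB Require Import structures.
From mathcomp Require Import all_boot all_order all_algebra.
(* [mpoly] has to be loaded before the files of MathComp-Analysis: in the other
   order its notations clash with theirs. *)
From mathcomp.multinomials Require Import mpoly.
From mathcomp Require Import all_classical all_reals.
From mathcomp Require Import topology normedtype convex.
Import Order.TTheory GRing.Theory Num.Theory.
Import numFieldNormedType.Exports.

Set Implicit Arguments.
Unset Strict Implicit.
Unset Printing Implicit Defensive.

Local Open Scope classical_set_scope.
Local Open Scope ring_scope.

(* The ring K[[x_1, ..., x_n]]: a series is the family of its coefficients,
   multiplied by the Cauchy product.  The alias carries its own ring structure;
   it is not the pointwise one that MathComp-Analysis puts on functions. *)
Definition mfps (n : nat) (K : comNzRingType) : Type := 'X_{1..n} -> K.

Notation "{ 'mfps' K [ n ] }" := (mfps n K) (format "{ 'mfps'  K [ n ] }").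

HB.instance Definition _ n K := GRing.Zmodule.copy {mfps K[n]} ('X_{1..n} -> K).

Section PowerSeries.
Variables (n : nat) (K : comNzRingType).
Implicit Types (f g h : {mfps K[n]}) (p q : {mpoly K[n]}) (m : 'X_{1..n}).

Definition mfps_of_mpoly p : {mfps K[n]} := fun m => p@_m.

Definition mfps_one : {mfps K[n]} := mfps_of_mpoly 1.

Definition mfps_mul f g : {mfps K[n]} := fun m =>
  \sum_(k : 'X_{1..n < (mdeg m).+1, (mdeg m).+1} | m == (k.1 + k.2)%MM)
    f k.1 * g k.2.

Definition mfps_scale (c : K) f : {mfps K[n]} := fun m => c * f m.

Lemma mfpsD f g m : (f + g) m = f m + g m. Proof. by []. Qed.

Lemma mfps_of_mpolyM p q :
  mfps_of_mpoly (p * q) = mfps_mul (mfps_of_mpoly p) (mfps_of_mpoly q).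
Proof. by apply/funext => m; rewrite /mfps_of_mpoly mcoeffM. Qed.

(* The coefficient of a product at m only depends on the coefficients of degree
   at most that of m, so the ring laws reduce to those of {mpoly K[n]}. *)
Definition mfps_trunc d f : {mpoly K[n]} :=
  \sum_(m : 'X_{1..n < d}) f m *: 'X_[m].

Lemma eq_mfps_mul m f f' g g' :
  (forall k, (mdeg k <= mdeg m)%N -> f k = f' k) ->
  (forall k, (mdeg k <= mdeg m)%N -> g k = g' k) ->
  mfps_mul f g m = mfps_mul f' g' m.
Proof.
move=> ff' gg'; apply: eq_bigr => k _.
by rewrite ff' ?gg' // -ltnS bmdeg.
Qed.

Lemma mfps_truncE d f m :
  (mdeg m < d)%N -> mfps_of_mpoly (mfps_trunc d f) m = f m.
Proof. exact: mcoeff_mpoly. Qed.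

Lemma mfps_mul_trunc d f g m : (mdeg m < d)%N ->
  mfps_mul f g m = (mfps_trunc d f * mfps_trunc d g)@_m.
Proof.
move=> md; rewrite -[RHS]/(mfps_of_mpoly _ m) mfps_of_mpolyM.
by apply: eq_mfps_mul => k km; rewrite mfps_truncE // (leq_ltn_trans km).
Qed.

Lemma mfps_mulA : associative mfps_mul.
Proof.
move=> f g h; apply/funext => m; pose T := mfps_trunc (mdeg m).+1.
have TE f' k : (mdeg k <= mdeg m)%N -> f' k = mfps_of_mpoly (T f') k.
  by move=> km; rewrite mfps_truncE.
have TM f' g' k : (mdeg k <= mdeg m)%N ->
    mfps_mul f' g' k = mfps_of_mpoly (T f' * T g') k.
  by move=> km; rewrite (@mfps_mul_trunc (mdeg m).+1).
rewrite (eq_mfps_mul (TE f) (TM g h)) -mfps_of_mpolyM mulrA.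
by rewrite mfps_of_mpolyM -(eq_mfps_mul (TM f g) (TE h)).
Qed.

Lemma mfps_mulC : commutative mfps_mul.
Proof.
move=> f g; apply/funext => m.
by rewrite !(@mfps_mul_trunc (mdeg m).+1) // mulrC.
Qed.

Lemma mfps_mul1 : left_id mfps_one mfps_mul.
Proof.
move=> f; apply/funext => m; pose T := mfps_trunc (mdeg m).+1.
have TE k : (mdeg k <= mdeg m)%N -> f k = mfps_of_mpoly (T f) k.
  by move=> km; rewrite mfps_truncE.
rewrite (eq_mfps_mul (fun _ _ => erefl) TE) -mfps_of_mpolyM mul1r.
by rewrite mfps_truncE.
Qed.

Lemma mfps_mulDl : left_distributive mfps_mul +%R.
Proof.
move=> f g h; apply/funext => m; rewrite mfpsD /mfps_mul -big_split /=.
by apply: eq_bigr => k _; rewrite mfpsD mulrDl.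
Qed.

Lemma mfps_one_neq0 : mfps_one != 0.
Proof.
apply/eqP => /(congr1 (fun f : {mfps K[n]} => f 0%MM)).
rewrite /mfps_one /mfps_of_mpoly mcoeff1 eqxx => /eqP.
by rewrite -[X in _ == X]/(0 : K) oner_eq0.
Qed.

HB.instance Definition _ := GRing.Zmodule_isComNzRing.Build {mfps K[n]}
  mfps_mulA mfps_mulC mfps_mul1 mfps_mulDl mfps_one_neq0.

Lemma mfps_scaleA a b f :
  mfps_scale a (mfps_scale b f) = mfps_scale (a * b) f.
Proof. by apply/funext => m; rewrite /mfps_scale mulrA. Qed.

Lemma mfps_scale1 : left_id 1 mfps_scale.
Proof. by move=> f; apply/funext => m; rewrite /mfps_scale mul1r. Qed.

Lemma mfps_scaleDr : right_distributive mfps_scale +%R.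
Proof. by move=> a f g; apply/funext => m; rewrite /mfps_scale mfpsD mulrDr. Qed.

Lemma mfps_scaleDl f : {morph mfps_scale^~ f : a b / a + b}.
Proof. by move=> a b; apply/funext => m; rewrite mfpsD /mfps_scale mulrDl. Qed.

HB.instance Definition _ := GRing.Zmodule_isLmodule.Build K {mfps K[n]}
  mfps_scaleA mfps_scale1 mfps_scaleDr mfps_scaleDl.

Lemma mfps_scaleAl a f g : a *: (f * g) = (a *: f) * g.
Proof.
apply/funext => m; rewrite -[LHS]/(a * mfps_mul f g m).
rewrite -[RHS]/(mfps_mul (mfps_scale a f) g m) /mfps_mul mulr_sumr.
by apply: eq_bigr => k _; rewrite /mfps_scale mulrA.
Qed.

HB.instance Definition _ :=
  GRing.Lmodule_isLalgebra.Build K {mfps K[n]} mfps_scaleAl.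

Definition mfps_ideal (k : nat) (f : 'I_k -> {mfps K[n]}) : set {mfps K[n]} :=
  [set h | exists a : 'I_k -> {mfps K[n]}, h = \sum_i a i * f i].

End PowerSeries.

Section IntersectionMultiplicity.
Variables (R : realType) (K : fieldType).

(* The classes of e form a K-basis of V / J. *)
Definition basis_mod (V : lmodType K) (J : set V) (d : nat) (e : 'I_d -> V) :=
  forall v : V, exists! c : 'rV[K]_d, J (v - \sum_i c 0 i *: e i).

(* dim_K (V / J), which is +oo when V / J has no finite basis *)
Definition codim (V : lmodType K) (J : set V) : \bar R :=
  xget +oo%E [set x | exists d : nat,
    x = d%:R%:E /\ exists e : 'I_d -> V, basis_mod J e].

(* [f_1, ..., f_n]_0 *)
Definition imult (n : nat) (f : 'I_n -> {mpoly K[n]}) : \bar R :=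
  codim (mfps_ideal (fun i => mfps_of_mpoly (f i))).

End IntersectionMultiplicity.

Section NewtonDiagram.
Variables (R : realType) (n : nat).

Definition exponent (m : 'X_{1..n}) : 'rV[R]_n := \row_i (m i)%:R.

Definition convex_hull (A : set 'rV[R]_n) : set 'rV[R]_n :=
  smallest (@convex_set R 'rV[R]_n) A.

Definition nonneg_orthant : set 'rV[R]_n := [set x | forall i, 0 <= x 0 i].

(* The subsets of P on which a linear form attains its minimum over P; P itself
   is included. *)
Definition is_face (P F : set 'rV[R]_n) := exists a : 'rV[R]_n,
  F = [set x | P x /\ forall y, P y ->
         \sum_i a 0 i * x 0 i <= \sum_i a 0 i * y 0 i].

(* R^I *)
Definition coord_subspace (I : {set 'I_n}) : set 'rV[R]_n :=
  [set x | forall i, i \notin I -> x 0 i = 0].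

Variable K : fieldType.

Definition newton_polytope (p : {mpoly K[n]}) : set 'rV[R]_n :=
  convex_hull [set exponent m | m in [set m | m \in msupp p]].

Definition newton_polyhedron (p : {mpoly K[n]}) : set 'rV[R]_n :=
  [set x + y | x in nonneg_orthant & y in newton_polytope p].

Definition newton_diagram (p : {mpoly K[n]}) : set 'rV[R]_n :=
  \bigcup_(F in [set F | is_face (newton_polyhedron p) F /\ compact F]) F.

End NewtonDiagram.

Arguments newton_diagram R {n K} p _.

Section DiagramMultiplicity.
Variables (R : realType) (K : fieldType) (n : nat).
Implicit Types Gamma : 'I_n -> set 'rV[R]_n.

Definition is_diagram (G : set 'rV[R]_n) :=
  exists p : {mpoly K[n]}, newton_diagram R p = G.

Definition diagram_imults Gamma : set (\bar R) :=
  [set imult R f | f in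
    [set f : 'I_n -> {mpoly K[n]} | forall i, newton_diagram R (f i) = Gamma i]].

(* [Gamma_1, ..., Gamma_n]_0, the least element of [diagram_imults Gamma] *)
Definition diagram_imult Gamma : \bar R :=
  xget +oo%E (diagram_imults Gamma `&` lbound (diagram_imults Gamma)).

(* The default value of [xget] is never used: the minimum exists. *)
Lemma diagram_imultP Gamma : (forall i, is_diagram (Gamma i)) ->
  diagram_imults Gamma (diagram_imult Gamma) /\
  lbound (diagram_imults Gamma) (diagram_imult Gamma).
Proof.
move=> dG; set S := diagram_imults Gamma.
suff [x Sx] : (S `&` lbound S) !=set0 by have := xgetI +oo%E Sx.
have Sval x : S x -> x = +oo%E \/ exists d : nat, x = d%:R%:E.
  move=> [f _ <-]; rewrite /imult /codim; case: xgetP => [y -> [d [-> _]]|_].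
    by right; exists d.
  by left.
have [f0 Hf0] : exists f : 'I_n -> {mpoly K[n]},
    forall i, newton_diagram R (f i) = Gamma i.
  by exists (fun i => projT1 (cid (dG i))) => i; exact: projT2 (cid (dG i)).
have Sf0 : S (imult R f0) by exists f0.
have [[d0 Sd0]|noS] := pselect (exists d : nat, S d%:R%:E); last first.
  exists (imult R f0); split => // y Sy.
  have [->|[d yd]] := Sval y Sy; first exact: leey.
  by case: noS; exists d; rewrite -yd.
have exS : exists d : nat, `[< S d%:R%:E >] by exists d0; apply/asboolP.
case: (ex_minnP exS) => d /asboolP Sd dmin.
exists d%:R%:E; split => // y Sy.
have [->|[d' yd]] := Sval y Sy; first exact: leey.
rewrite yd lee_fin ler_nat dmin //; apply/asboolP.
by rewrite -yd.
Qed.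

End DiagramMultiplicity.

(* Main.v *)
Require Import Defs.
From HB Require Import structures.
From mathcomp Require Import all_boot all_order all_algebra.
From mathcomp.multinomials Require Import mpoly.
From mathcomp Require Import all_classical all_reals.
From mathcomp Require Import topology normedtype convex.
Import Order.TTheory GRing.Theory Num.Theory.
Import numFieldNormedType.Exports.

Local Open Scope classical_set_scope.
Local Open Scope ring_scope.

Set Implicit Arguments.
Unset Strict Implicit.
Unset Printing Implicit Defensive.

(** Everything is read off the supports.  A diagram [Gamma] of a polynomial [p]
    meets the coordinate subspace of [I] exactly when [p] restricts to a nonzero
    polynomial there ([newton_diagram_meets]); for empty [I] this says that [0]
    lies on [Gamma] iff [p] has a constant term.  Part (1) follows: a system
    generates the unit ideal iff one of its members is a unit, that is, has a
    constant term ([mfps_unit], [imult_eq0]).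

    For part (2), necessity ([card_necessary]) is a growth estimate.  Let [k] be
    the number of [f_j] that do not vanish identically on the subspace of [I].
    If [d] elements span K[[x]] modulo the ideal of [f], then, on that subspace
    and up to order [s], every series is a combination of products of a spanning
    element with a monomial of degree less than [s] in these [k] series, because
    they have no constant term: about [d * s ^ k] generators.  The monomials in
    the variables of [I] span a space of dimension about [s ^ #|I|], so
    [#|I| <= k].

    Sufficiency needs one system with the prescribed supports.  Take its [N]
    coefficients [c] to be indeterminates.  On the torus of [I], each of the
    [k >= #|I|] equations that restrict to nonzero ones can be solved for one of
    its coefficients, so the [N + 1] elements [c] and [x_i], for a fixed [i] in
    [I], are expressed by the [N - k + #|I| <= N] elements formed by the other
    coefficients and the [x_j] with [j] in [I].  Hence they are algebraically
    dependent, and clearing denominators and powers of [x_i] gives a polynomial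
    [P] in [c] and [x_i] with [P(c, 0) <> 0] such that [P] times a power of the
    product [x_I] of the variables of [I] lies in the ideal generated by the
    system and the variables outside [I] ([perron_relation],
    [generic_relation]).  Over an infinite field the coefficients can be chosen
    nonzero and such that all the [P(c, 0)] stay nonzero ([exists_meval_neq0]);
    then every [P] becomes a unit of K[[x]].  So a power of [x_I] lies in
    [J + (x_i, i notin I)] for every nonempty [I], and descending induction on
    [I] puts every [x_I], in particular every variable, in the radical of the
    ideal [J] of the system ([sufficient_system]).  An ideal that contains a
    power of every variable has finite codimension ([codim_lty_of_powers]). *)

(** Distinct monomials in the variables of [I] stay distinct on the coordinate
    subspace of [I] and the others vanish there, so this is the nonvanishing of
    the restriction of [p]. *)
Definition nonzero_on (n : nat) (F : nzRingType) (I : {set 'I_n})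
    (p : {mpoly F[n]}) : Prop :=
  exists2 m, m \in msupp p & forall i, i \notin I -> m i = 0%N.

(** * Algebraic dependence modulo an ideal *)

Definition is_ideal (A : comNzRingType) (J : set A) :=
  [/\ J 0, (forall x y, J x -> J y -> J (x + y))
    & forall a x, J x -> J (a * x)].

Section Ideals.
Variables (A : comNzRingType) (J : set A).
Hypothesis idJ : is_ideal J.

Lemma ideal0 : J 0. Proof. by case: idJ. Qed.

Lemma idealD x y : J x -> J y -> J (x + y).
Proof. by case: idJ => _ + _; apply. Qed.

Lemma idealMl a x : J x -> J (a * x).
Proof. by case: idJ => _ _; apply. Qed.

Lemma idealMr a x : J x -> J (x * a).
Proof. by rewrite mulrC; exact: idealMl. Qed.

Lemma ideal_sum (I : Type) (r : seq I) (P : pred I) (F : I -> A) :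
  (forall i, P i -> J (F i)) -> J (\sum_(i <- r | P i) F i).
Proof. by move=> JF; apply: big_ind => //; [exact: ideal0|exact: idealD]. Qed.

End Ideals.

Section LinearDependence.
Variables (K : fieldType) (A : comNzRingType) (iota : {rmorphism K -> A}).
Variable J : set A.
Hypothesis idJ : is_ideal J.

(** The counting principle behind both directions: elements that are, modulo
    [J], combinations of fewer elements satisfy a linear relation modulo [J]. *)
Lemma linear_dependence (T1 T2 : finType) (v : T1 -> A) (w : T2 -> A) :
  (#|T2| < #|T1|)%N ->
  (forall a, exists c : T2 -> K, J (v a - \sum_b iota (c b) * w b)) ->
  exists l : T1 -> K, (exists a, l a != 0) /\ J (\sum_a iota (l a) * v a).
Proof.
move=> ltT /boolp.choice[c Jc].
pose M := \matrix_(i < #|T1|, j < #|T2|) c (enum_val i) (enum_val j).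
have : kermx M != 0.
  rewrite kermx_eq0 /row_free; apply: contraTneq ltT => rM.
  by rewrite -leqNgt -[X in (X <= _)%N]rM rank_leq_col.
case/rowV0Pn => r /sub_kermxP rM r0.
exists (fun a => r 0 (enum_rank a)); split.
  apply: contrapT => /forallNP r0'; move/eqP: r0; apply.
  apply/rowP => i; rewrite mxE -[i]enum_valK.
  by apply/eqP/negPn/negP; exact: r0'.
have sum0 : \sum_a iota (r 0 (enum_rank a)) * (\sum_b iota (c a b) * w b) = 0.
  under eq_bigr do rewrite mulr_sumr.
  rewrite exchange_big big1 // => b _.
  under eq_bigr do rewrite mulrA -rmorphM.
  rewrite -mulr_suml -rmorph_sum.
  have /rowP/(_ (enum_rank b)) := rM.
  rewrite !mxE (reindex (@enum_rank T1)) /=; last first.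
    by apply: onW_bij; exact: enum_rank_bij.
  under eq_bigr do rewrite mxE !enum_rankK.
  by move=> ->; rewrite rmorph0 mul0r.
rewrite -[X in J X]subr0 -[X in J (_ - X)]sum0 -sumrB.
apply: (ideal_sum idJ) => a _; rewrite -mulrBr.
exact: (idealMl idJ).
Qed.

Section Span.
Variables (q : nat) (y : 'I_q -> A).

(** Congruence modulo [J] takes the place of a quotient ring, and the degree
    bound [d] that of the filtration by degree of the subalgebra generated by
    the [y i]. *)
Definition poly_span (d : nat) (v : A) := exists w : {mpoly K[q]},
  (msize w <= d.+1)%N /\ J (v - mmap iota y w).

Lemma poly_spanW d d' v : (d <= d')%N -> poly_span d v -> poly_span d' v.
Proof.
by move=> dd' [w [wd Jw]]; exists w; split=> //; exact: leq_trans wd _.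
Qed.

Lemma poly_spanC c : poly_span 0 (iota c).
Proof.
exists c%:MP; split; first by rewrite mmeasureC leq_b1.
by rewrite mmapC subrr; exact: (ideal0 idJ).
Qed.

Lemma poly_span1 : poly_span 0 1.
Proof. by rewrite -(rmorph1 iota); exact: poly_spanC. Qed.

Lemma poly_span_var i : poly_span 1 (y i).
Proof.
exists 'X_i; split; first by rewrite msizeX mdeg1.
by rewrite mmapX mmap1U subrr; exact: (ideal0 idJ).
Qed.

Lemma poly_span_cong d v v' : J (v - v') -> poly_span d v' -> poly_span d v.
Proof.
move=> Jv [w [wd Jw]]; exists w; split => //.
by rewrite -[v](subrK v') -addrA; exact: (idealD idJ).
Qed.

Lemma poly_span0 d v : J v -> poly_span d v.
Proof.
move=> Jv; exists 0; split; last by rewrite rmorph0 subr0.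
by rewrite mmeasure0.
Qed.

Lemma poly_spanD d v v' : poly_span d v -> poly_span d v' ->
  poly_span d (v + v').
Proof.
move=> [w [wd Jw]] [w' [wd' Jw']]; exists (w + w'); split.
  by apply: leq_trans (mmeasureD_le _ _ _) _; rewrite geq_max wd wd'.
by rewrite rmorphD opprD addrACA; exact: (idealD idJ).
Qed.

Lemma poly_spanM d d' v v' : poly_span d v -> poly_span d' v' ->
  poly_span (d + d') (v * v').
Proof.
move=> [w [wd Jw]] [w' [wd' Jw']]; exists (w * w'); split.
  have [->|w0] := eqVneq w 0; first by rewrite mul0r mmeasure0.
  have [->|w0'] := eqVneq w' 0; first by rewrite mulr0 mmeasure0.
  rewrite msizeM // -subn1 leq_subLR.
  by apply: leq_trans (leq_add wd wd') _; rewrite !addSn addnS.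
rewrite rmorphM /=; set a := mmap _ _ w; set b := mmap _ _ w'.
have -> : v * v' - a * b = (v - a) * v' + a * (v' - b).
  by rewrite mulrBl mulrBr addrA subrK.
by apply: (idealD idJ); [exact: (idealMr idJ)|exact: (idealMl idJ)].
Qed.

Lemma poly_spanX d v k : poly_span d v -> poly_span (d * k) (v ^+ k).
Proof.
move=> dv; elim: k => [|k IHk]; first by rewrite muln0 expr0; exact: poly_span1.
by rewrite mulnS exprS; exact: poly_spanM.
Qed.

Lemma poly_span_prod (I : Type) (r : seq I) (d : I -> nat) (F : I -> A) :
  (forall i, poly_span (d i) (F i)) ->
  poly_span (\sum_(i <- r) d i) (\prod_(i <- r) F i).
Proof.
move=> dF; elim: r => [|i r IHr]; first by rewrite !big_nil; exact: poly_span1.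
by rewrite !big_cons; exact: poly_spanM.
Qed.

Lemma poly_span_sum (I : Type) (r : seq I) (P : pred I) d (F : I -> A) :
  (forall i, P i -> poly_span d (F i)) ->
  poly_span d (\sum_(i <- r | P i) F i).
Proof.
move=> dF; apply: big_ind => //; last exact: poly_spanD.
by apply: poly_span0; exact: (ideal0 idJ).
Qed.

End Span.

End LinearDependence.

Lemma card_bmultinom_le (q b : nat) : (#|{: 'X_{1..q < b}}| <= b ^ q)%N.
Proof.
case: b => [|b].
  by rewrite eq_card0 // => -[m mb].
pose f (m : 'X_{1..q < b.+1}) := [ffun i : 'I_q => inord (m i) : 'I_b.+1].
suff /leq_card : injective f by rewrite card_ffun !card_ord.
move=> m m' /ffunP fE; apply/val_inj/mnmP => i /=.
have lt (m1 : 'X_{1..q < b.+1}) : (m1 i < b.+1)%N.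
  by apply: leq_ltn_trans (bmdeg m1); rewrite mdegE (bigD1 i) //= leq_addr.
by have := fE i; rewrite !ffunE => /(congr1 val) /=; rewrite !inordK.
Qed.

Section Perron.
Variables (K : fieldType) (A : comNzRingType) (iota : {rmorphism K -> A}).
Variable J : set A.
Hypothesis idJ : is_ideal J.

(** Perron's argument with a denominator [u]: when [u] and the [u * z i] are
    polynomials in fewer elements [y] of degree at most [D], the monomials in [z]
    with exponents less than [t], multiplied by [u ^+ M] with [M = p * t], are
    polynomials in [y] of degree at most [D * M].  There are [t ^ p] of them in
    a space of dimension of the order of [t ^ q], hence a relation for large
    [t]. *)
Lemma perron_relation (q p D : nat) (y : 'I_q -> A) (z : 'I_p -> A) (u : A) :
  (q < p)%N -> poly_span iota J y D u ->
  (forall i, poly_span iota J y D (u * z i)) ->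
  exists P : {mpoly K[p]}, exists M : nat,
    P != 0 /\ J (u ^+ M * mmap iota z P).
Proof.
move=> qp uD zD.
(* [C] is such that [(D * M).+1 <= C * t], so that [C ^ q < t] is large
   enough for [(C * t) ^ q < t ^ p]. *)
pose C := (D * p).+1; pose t := (C ^ q).+1; pose M := (p * t)%N.
pose mon (a : {ffun 'I_p -> 'I_t}) := [multinom val (a i) | i < p].
have ltc : (#|{: 'X_{1..q < (D * M).+1}}| < #|{ffun 'I_p -> 'I_t}|)%N.
  rewrite card_ffun !card_ord; apply: leq_ltn_trans (card_bmultinom_le _ _) _.
  apply: (@leq_trans (t ^ q.+1)); last by rewrite leq_pexp2l.
  have : ((D * M).+1 <= C * t)%N.
    by rewrite /M /C mulnA mulSn -addn1 addnC leq_add2r.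
  move=> /leq_ltn_trans; rewrite expnS => le.
  apply: (@leq_ltn_trans ((C * t) ^ q)).
    by case: (q) => // q'; rewrite leq_exp2r // mulnA mulSn addnC -addn1 leq_add.
  by rewrite expnMn ltn_pmul2r // expn_gt0.
(* [M] is at least the total degree of any of the monomials, so each factor
   [z i] can be paired with a factor [u]. *)
pose v a := u ^+ M * mmap1 z (mon a).
have vD a : poly_span iota J y (D * M) (v a).
  pose s := (\sum_i a i)%N.
  have sM : (s <= M)%N.
    rewrite /M -[X in (_ <= X * _)%N]card_ord -sum_nat_const.
    by apply: leq_sum => i _; rewrite ltnW.
  have -> : v a = u ^+ (M - s) * \prod_i (u * z i) ^+ a i.
    under [X in _ = _ * X]eq_bigr do rewrite exprMn.
    rewrite big_split /= prodrXr mulrA -exprD subnK //.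
    by congr (_ * _); apply: eq_bigr => i _; rewrite mnmE.
  have -> : (D * M = D * (M - s) + \sum_i D * a i)%N.
    by rewrite -big_distrr -mulnDr subnK.
  apply: poly_spanM => //; first exact: poly_spanX.
  by apply: poly_span_prod => // i; exact: poly_spanX.
have vspan a : exists c : 'X_{1..q < (D * M).+1} -> K,
    J (v a - \sum_m iota (c m) * mmap1 y m).
  have [w [wd Jw]] := vD a; exists (fun m => w@_m).
  by rewrite -(mmapE _ wd).
have [l [[a0 la0] Jl]] := linear_dependence idJ ltc vspan.
exists (\sum_a l a *: 'X_[mon a]), M; split.
  apply: contra_neq la0 => /(congr1 (mcoeff (mon a0))).
  rewrite mcoeff0 raddf_sum (bigD1 a0) //= mcoeffZ mcoeffX eqxx mulr1.
  rewrite big1 ?addr0 // => a aa0; rewrite mcoeffZ mcoeffX.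
  case: eqP => [/mnmP E|]; last by rewrite mulr0.
  case/eqP: aa0; apply/ffunP => i; apply: val_inj.
  by have := E i; rewrite !mnmE.
rewrite raddf_sum /= mulr_sumr; under eq_bigr do rewrite mmapZ mmapX mulrCA.
exact: Jl.
Qed.

End Perron.

(** * Evaluation of multivariate polynomials *)

Lemma mcoeff_muni (n : nat) (F : comNzRingType) (p : {mpoly F[n.+1]})
    (m : 'X_{1..n.+1}) :
  ((muni p)`_(m ord_max))@_[multinom m (widen_ord (leqnSn n) i) | i < n]
    = p@_m.
Proof.
rewrite muniE coef_sum raddf_sum [in RHS](mpolyE p) [in RHS]raddf_sum /=.
apply: eq_bigr => m' _; rewrite coefZ coefXn mcoeffZ mcoeffX.
case: eqVneq => [m'E|nE]; last first.
  rewrite mulr0 mcoeff0; case: eqP => [E|_]; last by rewrite mulr0.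
  by rewrite E eqxx in nE.
rewrite mulr1 mcoeffZ mcoeffX; congr (_ * (nat_of_bool _)%:R).
apply/eqP/eqP => [/mnmP E|->] //; apply/mnmP => i.
have [->//|lt] : i = ord_max \/ (i < n)%N.
  case: (ltnP i n) => [|le]; first by right.
  by left; apply/val_inj/eqP => /=; rewrite eqn_leq le -ltnS ltn_ord.
by have := E (Ordinal lt); rewrite !mnmE; congr (_ = _); congr (fun_of_multinom _ _);
  apply: val_inj.
Qed.

Lemma muni_neq0 (n : nat) (F : comNzRingType) (p : {mpoly F[n.+1]}) :
  p != 0 -> muni p != 0.
Proof.
apply: contra_neq => p0; apply/mpolyP => m.
by rewrite -mcoeff_muni p0 coef0 !mcoeff0.
Qed.

(** Evaluation may be done one variable at a time; the last one is then the
    variable of a univariate polynomial, where roots can be factored out. *)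
Lemma mmap_muni (n : nat) (F S : comNzRingType) (f : {rmorphism F -> S})
    (z : 'I_n.+1 -> S) (p : {mpoly F[n.+1]}) :
  mmap f z p =
  (map_poly (mmap f (fun i => z (widen_ord (leqnSn n) i))) (muni p)).[z ord_max].
Proof.
rewrite muniE [in LHS](mpolyE p) !raddf_sum /= horner_sum.
apply: eq_bigr => m _. rewrite mmapZ mmapX.
rewrite map_polyZ hornerZ map_polyXn hornerXn /= mmapZ mmapX -mulrA.
rewrite /mmap1 big_ord_recr /=; congr (_ * (_ * _)).
by apply: eq_bigr => i _; rewrite mnmE.
Qed.

(** Induction on the number of variables: a point where the leading coefficient
    in the last variable is nonzero leaves a nonzero univariate polynomial. *)
Lemma exists_meval_neq0 (n : nat) (F : closedFieldType) (p : {mpoly F[n]}) :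
  p != 0 -> exists v : 'I_n -> F, p.@[v] != 0.
Proof.
elim: n p => [|n IHn] p p0.
  exists (fun=> 0); rewrite (nvar0_mpolyC p) mevalC.
  by apply: contra_neq p0 => p0; rewrite (nvar0_mpolyC p) p0.
have : lead_coef (muni p) != 0 by rewrite lead_coef_eq0 muni_neq0.
case/IHn => v vP.
have /closed_nonrootP[x px] : map_poly (meval v) (muni p) != 0.
  apply: contra_neq vP => /(congr1 (fun r : {poly F} => r`_(size (muni p)).-1)).
  by rewrite coef_map coef0.
exists (fun i => if unlift ord_max i is Some j then v j else x).
rewrite /meval mmap_muni unlift_none.
congr (~~ (_ == 0)): px; congr (_.[_]); apply: eq_map_poly => r /=.
apply: meval_eq => i; case: unliftP => [j|] /(congr1 val) /= E.
  by congr v; apply: val_inj; rewrite /= E /bump leqNgt ltn_ord.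
by have := ltn_ord i; rewrite E ltnn.
Qed.

(** * Power series and ideals of finite codimension *)

Section PowerSeriesTheory.
Variables (n : nat) (K : fieldType).
Implicit Types (f g : {mfps K[n]}) (p : {mpoly K[n]}) (m : 'X_{1..n}).

Lemma mfps_of_mpoly_additive : additive (@mfps_of_mpoly n K).
Proof. by move=> p q; apply/funext => m; exact: mcoeffB. Qed.

HB.instance Definition _ := GRing.isAdditive.Build {mpoly K[n]} {mfps K[n]}
  (@mfps_of_mpoly n K) mfps_of_mpoly_additive.

Lemma mfps_of_mpoly_multiplicative : multiplicative (@mfps_of_mpoly n K).
Proof. by split=> // p q; exact: mfps_of_mpolyM. Qed.

HB.instance Definition _ := GRing.isMultiplicative.Build
  {mpoly K[n]} {mfps K[n]} (@mfps_of_mpoly n K) mfps_of_mpoly_multiplicative.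

Lemma mfps_of_mpolyZ c p : mfps_of_mpoly (c *: p) = c *: mfps_of_mpoly p.
Proof. by apply/funext => m; exact: mcoeffZ. Qed.

Lemma mfpsZ c f m : (c *: f) m = c * f m. Proof. by []. Qed.

Lemma mfpsN f m : (- f) m = - f m. Proof. by []. Qed.

Lemma mfpsM f g m : (f * g) m = mfps_mul f g m. Proof. by []. Qed.

Lemma mfps1 m : (1 : {mfps K[n]}) m = (m == 0%MM)%:R.
Proof. by rewrite -(rmorph1 (@mfps_of_mpoly n K)) -mcoeff1. Qed.

Lemma mfps_sum (T : Type) (r : seq T) (P : pred T) (F : T -> {mfps K[n]}) m :
  (\sum_(i <- r | P i) F i) m = \sum_(i <- r | P i) F i m.
Proof. exact: (big_morph (fun f : {mfps K[n]} => f m)). Qed.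

Lemma mfps_constM f g : (f * g) 0%MM = f 0%MM * g 0%MM.
Proof.
rewrite mfpsM (@mfps_mul_trunc _ _ 1) ?mdeg0 // rmorphM /=.
by congr (_ * _); apply: (@mfps_truncE _ _ 1); rewrite mdeg0.
Qed.

Lemma mfps_mulX f m0 m : (f * mfps_of_mpoly 'X_[m0]) m =
  if (m0 <= m)%MM then f (m - m0)%MM else 0.
Proof.
pose p := mfps_trunc (mdeg m).+1 f.
have -> : (f * mfps_of_mpoly 'X_[m0]) m = (p * 'X_[m0])@_m.
  rewrite mfpsM -[RHS]/(mfps_of_mpoly _ m) mfps_of_mpolyM.
  by apply: eq_mfps_mul => // k km; rewrite mfps_truncE.
case: ifPn => [le|nle].
  rewrite -[in LHS](submK le) addmC mcoeffMX.
  by apply: (@mfps_truncE _ _ (mdeg m).+1); rewrite ltnS mdegB.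
apply: memN_msupp_eq0; apply: contra nle.
by rewrite (perm_mem (msuppMX _ _)) => /mapP[m' _ ->]; exact: lem_addr.
Qed.

(** The series whose restriction to the coordinate subspace of [I] has order at
    least [s]: the coefficients with exponents in [I] stand for that
    restriction, which avoids a second ring with fewer variables. *)
Definition vanishing (I : {set 'I_n}) (s : nat) : set {mfps K[n]} :=
  [set f | forall m, (forall i, i \notin I -> m i = 0%N) -> (mdeg m < s)%N ->
     f m = 0].

Lemma vanishingM I s s' f g : vanishing I s f -> vanishing I s' g ->
  vanishing I (s + s') (f * g).
Proof.
move=> fs gs m mI mss; rewrite mfpsM /mfps_mul big1 // 
  => -[[k1 ?] [k2 ?]] /= /eqP mE.
have kI k : (k <= m)%MM -> forall i, i \notin I -> k i = 0%N.
  by move=> /mnm_lepP km i /mI mi; have := km i; rewrite mi leqn0 => /eqP.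
have [lt1|le1] := ltnP (mdeg k1) s.
  by rewrite fs ?mul0r //; apply: kI; rewrite mE lem_addr.
rewrite gs ?mulr0 //; first by apply: kI; rewrite mE lem_addl.
rewrite -(ltn_add2l (mdeg k1)) -mdegD -mE (leq_trans mss) //.
by rewrite leq_add2r.
Qed.

Lemma vanishing_ideal I s : is_ideal (vanishing I s).
Proof.
split => [//|f g fs gs m mI ms|a f fs].
  by rewrite mfpsD fs ?gs ?addr0.
by rewrite -[s]add0n; apply: vanishingM.
Qed.

Lemma vanishingX I s k f : vanishing I s f -> vanishing I (s * k) (f ^+ k).
Proof.
move=> fs; elim: k => [|k IHk]; first by rewrite muln0.
by rewrite mulnS exprS; exact: vanishingM.
Qed.

Lemma vanishing_const I f : f 0%MM = 0 -> vanishing I 1 f.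
Proof. by move=> f0 m _; rewrite ltnS leqn0 mdeg_eq0 => /eqP ->. Qed.

(** The geometric series inverts [1 - h] when [h] has no constant term. *)
Lemma mfps_unit f : f 0%MM != 0 -> exists g, g * f = 1.
Proof.
move=> f0; pose h : {mfps K[n]} := 1 - (f 0%MM)^-1 *: f.
have hX k : vanishing [set: 'I_n]%SET k (h ^+ k).
  rewrite -[k in vanishing _ k]mul1n; apply/vanishingX/vanishing_const.
  by rewrite /h mfpsD mfpsN mfpsZ mulVf // mfps1 eqxx subrr.
pose G : {mfps K[n]} := fun m => (\sum_(k < (mdeg m).+1) h ^+ k) m.
have GE : G * (1 - h) = 1.
  apply/funext => m; rewrite mfpsM.
  have -> : mfps_mul G (1 - h) m = ((\sum_(k < (mdeg m).+1) h ^+ k) * (1 - h)) m.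
    apply: eq_mfps_mul => // m' le; rewrite /G !mfps_sum.
    rewrite (big_ord_widen_cond _ xpredT (fun k => (h ^+ k) m')
               (_ : (mdeg m').+1 <= (mdeg m).+1)%N) // big_mkcond /=.
    apply: eq_bigr => k _; case: ltnP => // lt.
    by rewrite hX // => i; rewrite inE.
  rewrite mulrC -opprB mulNr -subrX1 opprB mfpsD mfpsN hX ?subr0 //.
  by move=> i; rewrite inE.
exists ((f 0%MM)^-1 *: G); rewrite -GE /h opprB addrC subrK.
by rewrite -scalerAl [RHS]mulrC -scalerAl mulrC.
Qed.

Lemma mfps_ideal_ideal k (f : 'I_k -> {mfps K[n]}) : is_ideal (mfps_ideal f).
Proof.
split.
- by exists (fun=> 0); rewrite big1 // => i _; rewrite mul0r.
- move=> _ _ [a ->] [b ->]; exists (fun i => a i + b i).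
  by rewrite -big_split; apply: eq_bigr => i _; rewrite mulrDl.
- move=> c _ [a ->]; exists (fun i => c * a i).
  by rewrite mulr_sumr; apply: eq_bigr => i _; rewrite mulrA.
Qed.

Lemma mfps_ideal_gen k (f : 'I_k -> {mfps K[n]}) i : mfps_ideal f (f i).
Proof.
exists (fun j => (j == i)%:R); rewrite (bigD1 i) //= eqxx mul1r.
by rewrite big1 ?addr0 // => j /negPf ->; rewrite mul0r.
Qed.

End PowerSeriesTheory.

Section Codimension.
Variables (R : realType) (K : fieldType).

Definition spans_mod (V : lmodType K) (J : set V) d (e : 'I_d -> V) :=
  forall v, exists c : 'rV[K]_d, J (v - \sum_i c 0 i *: e i).

(** A spanning family is shortened along nontrivial relations until it is
    independent. *)
Lemma spans_mod_basis (V : lmodType K) (J : set V) d (e : 'I_d -> V) :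
  J 0 -> (forall x y, J x -> J y -> J (x + y)) ->
  (forall (a : K) x, J x -> J (a *: x)) ->
  spans_mod J e -> exists d' (e' : 'I_d' -> V), basis_mod J e'.
Proof.
move=> J0 JD JZ; elim: d e => [|d IHd] e eJ.
  exists 0%N, e => v; have [c Jc] := eJ v; exists c; split => // c' _.
  by apply/rowP => -[].
have JB x y : J x -> J y -> J (x - y).
  by move=> Jx Jy; apply: JD => //; rewrite -scaleN1r; apply: JZ.
have [indep|] := pselect (forall c : 'rV[K]_d.+1,
    J (\sum_i c 0 i *: e i) -> c = 0).
  exists d.+1, e => v; have [c Jc] := eJ v; exists c; split => // c' Jc'.
  apply/eqP; rewrite -subr_eq0; apply/eqP/indep.
  under eq_bigr do rewrite !mxE scalerBl.
  rewrite sumrB; set x := \sum_i _; set x' := \sum_i _.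
    have -> : x - x' = (v - x') - (v - x) by rewrite opprB [RHS]addrC addrA subrK.
  exact: JB.
move=> /existsNP[c /not_implyP[Jc /eqP/rV0Pn[k ck]]].
apply: (IHd (fun i => e (lift k i))) => v; have [b Jb] := eJ v.
exists (\row_i (b 0 (lift k i) - b 0 k / c 0 k * c 0 (lift k i))).
have := JD _ _ Jb (JZ (b 0 k / c 0 k) _ Jc); congr J.
rewrite -addrA; congr (_ + _).
rewrite (bigD1_ord k) //= [in X in _ + X](bigD1_ord k) //=.
rewrite scalerDr scalerA divfK // opprD addrACA addNr add0r.
rewrite scaler_sumr -!sumrN -big_split; apply: eq_bigr => i _ /=.
by rewrite mxE scalerBl opprB addrC scalerA.
Qed.

Variables (n : nat) (J : set {mfps K[n]}).
Hypothesis idJ : is_ideal J.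

Lemma codim_lty : (codim R J < +oo)%E <->
  exists d (e : 'I_d -> {mfps K[n]}), spans_mod J e.
Proof.
rewrite /codim; case: xgetP => [x _ [d [-> [e eJ]]]|noJ].
  split => _; last by rewrite ltry.
  by exists d, e => v; have [c [Jc _]] := eJ v; exists c.
split=> [|[d [e eJ]]]; first by rewrite ltxx.
have [||a x Jx|d' [e' eJ']] := spans_mod_basis _ _ _ eJ.
- exact: (ideal0 idJ).
- exact: (idealD idJ).
- by rewrite -[x]mul1r scalerAl; exact: (idealMl idJ).
by case: (noJ d'%:R%:E); exists d'; split=> //; exists e'.
Qed.

(** A family of positive length is never a basis of the zero quotient, since any
    coordinates represent [0] there; so length 0 is the only one available. *)
Lemma codim_eq0 : codim R J = 0%E <-> J 1.
Proof.
have JT : J 1 -> forall v, J v.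
  by move=> J1 v; rewrite -[v]mulr1; exact: (idealMl idJ).
rewrite /codim; case: xgetP => [x _ [d [-> [e eJ]]]|noJ].
  case: d e eJ => [|d] e eJ.
    split => // _; have [c [Jc _]] := eJ 1.
    by rewrite big_ord0 subr0 in Jc.
  split; first by move=> [/eqP]; rewrite pnatr_eq0.
  move=> /JT J1; have [c [_ cE]] := eJ 0.
  have /rowP/(_ ord0) := etrans (esym (cE 0 (J1 _))) (cE (const_mx 1) (J1 _)).
  by rewrite !mxE => /esym/eqP; rewrite oner_eq0.
split => // J1; case: (noJ 0%E); exists 0%N; split => //.
exists (fun=> 0) => v; exists 0; split; first exact: JT.
by move=> c _; apply/rowP => -[].
Qed.

(** Modulo the [x_i ^ N] only the finitely many monomials with all exponents less
    than [N] survive. *)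
Lemma codim_lty_of_powers N :
  (forall i, J (mfps_of_mpoly 'X_i ^+ N)) -> (codim R J < +oo)%E.
Proof.
move=> JX; apply/codim_lty.
have reduce (s : seq 'I_n) (v : {mfps K[n]}) : exists w : {mfps K[n]}, J (v - w) /\
    forall i (m : 'X_{1..n}), i \in s -> (N <= m i)%N -> w m = 0.
  elim: s => [|i s [w [Jw ws]]].
    by exists v; rewrite subrr; split=> //; exact: (ideal0 idJ).
  (* [w1] is the remainder of [w] modulo [x_i ^ N], and [a] below the
     quotient; taking remainders deletes coefficients, so the bounds on the
     exponents of the other variables persist. *)
  pose w1 : {mfps K[n]} := fun m => if (m i < N)%N then w m else 0.
  exists w1; split; last first.
    move=> j m; rewrite inE => /predU1P[->|js] le; rewrite /w1.
      by rewrite ltnNge le.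
    by case: ifP => // _; exact: ws js le.
  rewrite -[v](subrK w) -addrA; apply: (idealD idJ) => //.
  pose a : {mfps K[n]} := fun m => w (m + U_(i) *+ N)%MM.
  suff -> : w - w1 = a * mfps_of_mpoly 'X_i ^+ N by exact: (idealMl idJ).
  apply/funext => m; rewrite -rmorphXn mpolyXn mfps_mulX mfpsD mfpsN /w1 /a.
  have -> : (U_(i) *+ N <= m)%MM = (N <= m i)%N.
    apply/mnm_lepP/idP => [/(_ i)|le j]; rewrite mulmnE mnm1E.
      by rewrite eqxx mul1n.
    by case: eqP => [<-|_]; rewrite ?mul1n ?mul0n.
  case: ltnP => [_|le]; first by rewrite subrr.
  rewrite subr0 submK //; apply/mnm_lepP => j; rewrite mulmnE mnm1E.
  by case: eqP => [<-|_]; rewrite ?mul1n ?mul0n.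
(* A monomial with all exponents less than [N] has degree less than [d]. *)
pose d := (n * N).+1.
exists #|{: 'X_{1..n < d}}|,
  (fun i => mfps_of_mpoly 'X_[(enum_val i : 'X_{1..n < d})]) => v.
have [w [Jw wN]] := reduce (enum 'I_n) v.
exists (\row_i w (enum_val i : 'X_{1..n < d})); congr J: Jw; congr (_ - _).
transitivity (mfps_of_mpoly (mfps_trunc d w)).
  apply/funext => m; have [lt|le] := ltnP (mdeg m) d.
    by rewrite mfps_truncE.
  have [i iN] : exists i, (N <= m i)%N.
    apply: contrapT => /forallNP noi.
    have : (mdeg m <= \sum_(i < n) N)%N.
      rewrite mdegE; apply: leq_sum => i _.
      by apply: ltnW; rewrite ltnNge; apply/negP; exact: noi.
    by rewrite sum_nat_const card_ord leqNgt le.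
  rewrite (wN i) ?mem_enum //; apply/esym/memN_msupp_eq0.
  apply/negP => /msize_mdeg_lt; apply/negP; rewrite -leqNgt.
  apply: leq_trans le; apply: (leq_trans (mmeasure_sum _ _ _ _)).
  apply/bigmax_leqP => m' _; apply: leq_trans (msizeZ_le _ _) _.
  by rewrite msizeX bmdeg.
rewrite /mfps_trunc raddf_sum /=.
rewrite (reindex (fun i : 'I_#|{: 'X_{1..n < d}}| => enum_val i)) /=; last first.
  by apply: onW_bij; exact: enum_val_bij.
by apply: eq_bigr => i _; rewrite mfps_of_mpolyZ mxE.
Qed.

End Codimension.

(** * Newton diagrams and coordinate subspaces *)

(** Exponents that occur in a finite support are less than some [B], so the
    weights [B ^ i] tell all monomials of the support apart. *)
Lemma digits_inj (n B : nat) (f g : 'I_n -> nat) :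
  (forall i, f i < B)%N -> (forall i, g i < B)%N ->
  (\sum_i f i * B ^ i = \sum_i g i * B ^ i)%N -> f =1 g.
Proof.
elim: n f g => [|n IHn] f g fB gB; first by move=> _ [].
have shift (h : 'I_n.+1 -> nat) : (\sum_i h i * B ^ i =
    (\sum_i h (lift ord0 i) * B ^ i) * B + h ord0)%N.
  rewrite big_ord_recl expn0 muln1 addnC big_distrl; congr (_ + _)%N.
  by apply: eq_bigr => i _; rewrite lift0 expnS mulnCA mulnC.
rewrite !shift => fg.
have B0 : (0 < B)%N by apply: leq_ltn_trans (fB ord0).
have f0 : f ord0 = g ord0.
  by have := congr1 (modn^~ B) fg; rewrite /= !modnMDl !modn_small.
move: fg; rewrite f0 => /addIn /eqP; rewrite eqn_pmul2r // => /eqP.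
move=> /IHn fgS i; case: (unliftP ord0 i) => [j|] -> //.
by apply: fgS.
Qed.

Section Diagram.
Variables (R : realType) (n : nat).
Implicit Types (a x y : 'rV[R]_n) (A M : set 'rV[R]_n).

Definition weight a x : R := \sum_i a 0 i * x 0 i.

Lemma weightD a x y : weight a (x + y) = weight a x + weight a y.
Proof.
by rewrite /weight -big_split; apply: eq_bigr => i _; rewrite mxE mulrDr.
Qed.

Lemma weightZ a t x : weight a (t *: x) = t * weight a x.
Proof. by rewrite /weight mulr_sumr; apply: eq_bigr => i _; rewrite mxE mulrCA. Qed.

Lemma weight_exponent (w : 'I_n -> nat) (m : 'X_{1..n}) :
  weight (\row_i (w i)%:R) (exponent R m) = (\sum_i m i * w i)%:R.
Proof.
by rewrite natr_sum; apply: eq_bigr => i _; rewrite !mxE natrM mulrC.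
Qed.

Lemma convex_hull_sub A M : A `<=` M ->
  (forall x y (t : R), M x -> M y -> 0 < t < 1 -> M (t *: x + (1 - t) *: y)) ->
  convex_hull A `<=` M.
Proof.
move=> AM cM; apply: smallest_sub => //; apply/convex_setW => x y Mx My k k0 k1.
by rewrite inE in Mx; rewrite inE in My; rewrite inE; apply: cM => //; apply/andP.
Qed.

Variables (K : fieldType).
Implicit Types (p q : {mpoly K[n]}) (I : {set 'I_n}).

Lemma newton_polytope_exponent p m :
  m \in msupp p -> newton_polytope p (exponent R m).
Proof. by move=> mp; apply: sub_gen_smallest; exists m. Qed.

Lemma newton_polyhedron_exponent p m :
  m \in msupp p -> newton_polyhedron p (exponent R m).
Proof.
move=> mp; exists 0; first by move=> i; rewrite mxE.
by exists (exponent R m); [exact: newton_polytope_exponent|rewrite add0r].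
Qed.

(** If the minimum of a positive weight over the support is attained only once,
    at [m0], then [exponent m0] is by itself a compact face. *)
Lemma newton_diagram_vertex p (w : 'I_n -> nat) m0 :
  m0 \in msupp p -> (forall i, 0 < w i)%N ->
  {in msupp p, forall m, m != m0 ->
     (\sum_i m0 i * w i < \sum_i m i * w i)%N} ->
  newton_diagram R p (exponent R m0).
Proof.
move=> m0p w0 wmin; pose a : 'rV[R]_n := \row_i (w i)%:R.
set e0 := exponent R m0.
have hull z : newton_polytope p z -> z = e0 \/ weight a e0 < weight a z.
  apply: (@convex_hull_sub _ [set z | z = e0 \/ weight a e0 < weight a z]).
    move=> _ [m mp <-] /=; have [->|mm0] := eqVneq m m0; first by left.
    by right; rewrite !weight_exponent ltr_nat wmin.
  move=> x y t Mx My /andP[t0 t1].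
  have u0 : 0 < 1 - t by rewrite subr_gt0.
  have E : weight a e0 = t * weight a e0 + (1 - t) * weight a e0.
    by rewrite -mulrDl addrC subrK mul1r.
  case: Mx My => [->|lx] [->|ly].
  - by left; rewrite -scalerDl addrC subrK scale1r.
  - by right; rewrite weightD !weightZ {1}E ltrD2l ltr_pM2l.
  - by right; rewrite weightD !weightZ {1}E ltrD2r ltr_pM2l.
  - by right; rewrite weightD !weightZ {1}E ltrD // ltr_pM2l.
have nonneg y : nonneg_orthant y -> 0 <= weight a y.
  by move=> y0; apply: sumr_ge0 => i _; rewrite mxE mulr_ge0 ?ler0n.
have hull_le z : newton_polytope p z -> weight a e0 <= weight a z.
  by move=> /hull[->|/ltW].
exists [set e0] => //; split; last exact: compact_set1.
exists a; apply/seteqP; split => [_ ->|x].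
  split; first exact: newton_polyhedron_exponent.
  move=> _ [y y0 [z /hull_le ze <-]].
  by rewrite -!/(weight _ _) weightD -[leLHS]add0r lerD // nonneg.
move=> [[y y0 [z zp <-]] /(_ _ (newton_polyhedron_exponent m0p))].
rewrite -!/(weight _ _) weightD => le.
have le0 := nonneg _ y0.
have [ze|lt] := hull _ zp; last first.
  by move: le; rewrite leNgt ltr_wpDl.
rewrite ze; suff -> : y = 0 by rewrite add0r.
have : weight a y == 0.
  by rewrite eq_le le0 andbT -(lerD2r (weight a e0)) add0r -{1}ze.
rewrite psumr_eq0; last by move=> i _; rewrite mxE mulr_ge0 ?ler0n.
move=> /allP y00; apply/rowP => i; rewrite [RHS]mxE.
have := y00 i (mem_index_enum i); rewrite mxE mulf_eq0 pnatr_eq0.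
by rewrite gtn_eqF // => /eqP.
Qed.

(** Convexity gives one direction: without exponents in the subspace, the
    polyhedron stays away from it.  For the other, a weight that separates
    monomials and is large outside [I] is minimal at a single exponent, which
    lies in the subspace and is a vertex of the diagram. *)
Lemma newton_diagram_meets p I :
  (newton_diagram R p `&` coord_subspace I !=set0) <->
  nonzero_on I p.
Proof.
split=> [[x [[F [[a ->] _] [xp _]] xI]]|[m1 m1p m1I]].
  apply: contrapT => noI; case: xp => y y0 [z zp xE].
  (* The sum of the coordinates outside [I] is positive on the support, hence on
     the whole polyhedron, but zero on the subspace. *)
  pose b : 'rV[R]_n := \row_i (i \notin I)%:R.
  have /(_ _ zp) zb : newton_polytope p `<=` [set z | 0 < weight b z].
    apply: convex_hull_sub => [_ [m mp <-]|u v t /= u0 v0 /andP[t0 t1]].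
      rewrite /= weight_exponent ltr0n lt0n; apply/negP => /eqP m0.
      case: noI; exists m => // i iI.
      have /eqP := m0; rewrite sum_nat_eq0 => /forallP/(_ i).
      by rewrite iI muln1 => /eqP.
    by rewrite weightD !weightZ addr_gt0 // mulr_gt0 // subr_gt0.
  have : weight b x = 0.
    apply: big1 => i _; rewrite mxE; have [iI|/xI ->] := boolP (i \in I).
      by rewrite mul0r.
    by rewrite mulr0.
  rewrite -xE weightD => /eqP; rewrite gt_eqF // ltr_wpDl //.
  by apply: sumr_ge0 => i _; rewrite mxE mulr_ge0 ?ler0n.
pose inI (m : 'X_{1..n}) := [forall i, (i \notin I) ==> (m i == 0%N)].
have inIP (m : 'X_{1..n}) : reflect (forall i, i \notin I -> m i = 0%N) (inI m).
  by apply: (iffP 'forall_implyP) => mI i /mI/eqP.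
pose B := msize p.
pose wt (m : 'X_{1..n}) := (\sum_i m i * B ^ i)%N.
have mB (m : 'X_{1..n}) i : m \in msupp p -> (m i < B)%N.
  by move=> /msize_mdeg_lt; apply: leq_ltn_trans; rewrite mdegE (bigD1 i) ?leq_addr.
have exwt : exists v, has (fun m => inI m && (wt m == v)) (msupp p).
  by exists (wt m1); apply/hasP; exists m1; rewrite // eqxx andbT; apply/inIP.
case: (ex_minnP exwt) => v /hasP[m0 m0p /andP[m0I /eqP m0v]] vmin.
exists (exponent R m0); split; last first.
  by move=> i /(inIP _ m0I) E; rewrite mxE E.
have B0 : (0 < B)%N by apply: leq_ltn_trans (msize_mdeg_lt m0p).
(* The exponents in [I] keep the weight [wt], whose minimum [v] is attained at
   [m0] only; the others get a weight greater than [v]. *)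
apply: (newton_diagram_vertex
  (w := fun i : 'I_n => (B ^ i + (i \notin I) * v.+1)%N)) => //.
  by move=> i; rewrite ltn_addr // expn_gt0 B0.
move=> m mp mm0.
have wE (m' : 'X_{1..n}) :
    (\sum_i m' i * (B ^ i + (i \notin I) * v.+1) =
     wt m' + \sum_i m' i * ((i \notin I) * v.+1))%N.
  by rewrite -big_split; apply: eq_bigr => i _; rewrite mulnDr.
have inI0 m' : inI m' -> (\sum_i m' i * ((i \notin I) * v.+1) = 0)%N.
  move=> /inIP m'I; apply: big1 => i _; case: (boolP (i \in I)) => iI.
    by rewrite mul0n muln0.
  by rewrite m'I.
rewrite !wE (inI0 _ m0I) addn0 m0v.
have [mI|/forallPn[i]] := boolP (inI m).
  rewrite (inI0 _ mI) addn0 ltn_neqAle vmin ?andbT; last first.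
    by apply/hasP; exists m => //; rewrite mI eqxx.
  rewrite -m0v; apply: contra mm0 => /eqP /digits_inj E.
  by apply/eqP/mnmP => i; rewrite E // => j; apply: mB.
rewrite negb_imply => /andP[iI mi].
apply: leq_trans (leq_addl _ _); rewrite (bigD1 i) //= iI mul1n.
by apply: leq_trans (leq_addr _ _); rewrite leq_pmull // lt0n.
Qed.

Lemma newton_diagram_supp p q :
  msupp p =i msupp q -> newton_diagram R p = newton_diagram R q.
Proof.
move=> pq; rewrite /newton_diagram /newton_polyhedron /newton_polytope.
suff -> : [set m | m \in msupp p] = [set m | m \in msupp q] by [].
by apply/seteqP; split => m /=; rewrite pq.
Qed.

Lemma newton_diagram0 p : newton_diagram R p 0 <-> 0%MM \in msupp p.
Proof.
have := newton_diagram_meets p finset.set0.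
have -> : newton_diagram R p `&` coord_subspace finset.set0 !=set0 <->
    newton_diagram R p 0.
  split=> [[x [xp x0]]|p0].
    by suff <- : x = 0 by []; apply/rowP => i; rewrite x0 ?inE // mxE.
  by exists 0; split => // i _; rewrite mxE.
move=> ->; split => [[m mp m0]|p0].
  by have <- : m = 0%MM; [apply/mnmP => i; rewrite m0 ?inE // mnm0E|].
by exists 0%MM => // i _; rewrite mnm0E.
Qed.

End Diagram.

(** * Necessity: a growth estimate *)

Section Necessity.
Variables (K : fieldType) (n : nat) (f : 'I_n -> {mpoly K[n]}).
Variables (d : nat) (e : 'I_d -> {mfps K[n]}).
Hypothesis f0 : forall j, 0%MM \notin msupp (f j).
Hypothesis eJ : spans_mod (mfps_ideal (fun i => mfps_of_mpoly (f i))) e.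
Variable I : {set 'I_n}.

Let B := [set j : 'I_n | `[< nonzero_on I (f j) >] ]%SET.

Let g (b : 'I_#|B|) : {mfps K[n]} := mfps_of_mpoly (f (enum_val b)).

Let iota : {rmorphism K -> {mfps K[n]}} := in_alg {mfps K[n]}.

(** Iteration of [v = \sum_i c_i e_i + \sum_j a_j f_j]: each round applies the
    expansion to the coefficients [a_j] with [j] in [B].  The error terms gain
    one order in each round, since [f_j] has no constant term.  The other [f_j]
    vanish on the subspace of [I]. *)
Lemma approx_by_powers s (v : {mfps K[n]}) :
  exists w : 'I_d -> {mpoly K[#|B|]}, (forall i, msize (w i) <= s)%N /\
    vanishing I s (v - \sum_i e i * mmap iota g (w i)).
Proof.
elim: s v => [|s IHs] v.
  by exists (fun=> 0); split=> // i; rewrite mmeasure0.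
have [c [a vE]] := eJ v.
have /boolp.choice[w wP] (b : 'I_#|B|) := IHs (a (enum_val b)).
exists (fun i => (c 0 i)%:MP + \sum_b 'X_b * w b i); split=> [i|].
  apply: leq_trans (mmeasureD_le _ _ _) _; rewrite geq_max; apply/andP; split.
    by rewrite mmeasureC; apply: leq_trans (leq_b1 _) _.
  apply: leq_trans (mmeasure_sum _ _ _ _) _; apply/bigmax_leqP => b _.
  have [->|w0] := eqVneq (w b i) 0; first by rewrite mulr0 mmeasure0.
  rewrite mulrC msizeM ?msizeX ?mdeg1 ?addn2 //=; last first.
    by rewrite -msize_poly_eq0 msizeX.
  by rewrite ltnS; case: (wP b).
have idV := vanishing_ideal K I s.+1.
have -> : v - \sum_i e i * mmap iota g ((c 0 i)%:MP + \sum_b 'X_b * w b i) =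
    \sum_(j | j \notin B) a j * mfps_of_mpoly (f j) +
    \sum_b (a (enum_val b) - \sum_i e i * mmap iota g (w b i)) * g b.
  have -> : \sum_i e i * mmap iota g ((c 0 i)%:MP + \sum_b 'X_b * w b i) =
      \sum_i c 0 i *: e i +
      \sum_b (\sum_i e i * mmap iota g (w b i)) * g b.
    under [X in _ = _ + X]eq_bigr do rewrite mulr_suml.
    rewrite exchange_big -big_split; apply: eq_bigr => i _ /=.
    rewrite rmorphD rmorph_sum /= mmapC mulrDr mulr_sumr; congr (_ + _).
      by rewrite mulrC -scalerAl mul1r.
    apply: eq_bigr => b _.
        by rewrite rmorphM /= mmapX mmap1U [g b * _]mulrC mulrA.
  under [X in _ = _ + X]eq_bigr do rewrite mulrBl.
  rewrite opprD addrA vE sumrB addrA; congr (_ - _).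
  rewrite (bigID (mem B)) /= addrC; congr (_ + _).
  by rewrite big_enum_val.
apply: (idealD idV); apply: (ideal_sum idV).
  move=> j jB; apply: (idealMl idV) => m mI _; apply: memN_msupp_eq0.
  by apply: contra jB => mf; rewrite inE; apply/asboolP; exists m.
move=> b _; rewrite -addn1; apply: vanishingM; first by case: (wP b).
by apply: vanishing_const; apply: memN_msupp_eq0.
Qed.

Lemma card_necessary : (#|I| <= #|B|)%N.
Proof.
rewrite leqNgt; apply/negP => ltBI.
(* The monomials supported in [I] with exponents at most [t] are [t.+1 ^ #|I|]
   in number and have degree less than [s]; as [s <= C * t.+1], this [t] makes
   them more numerous than the [d * s ^ #|B|] generators. *)
pose C := n.+1; pose t := (d * C ^ #|B|)%N; pose s := (n * t).+1.
pose T1 := {a : {ffun 'I_n -> 'I_t.+1} | a \in pffun_on ord0 (mem I) predT}.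
pose mon (a : T1) := [multinom val (val a i) | i < n].
have monI a i : i \notin I -> mon a i = 0%N.
  have /pfamilyP[/supportP aI _] := valP a.
  by move=> iI; rewrite mnmE aI.
have mons a : (mdeg (mon a) < s)%N.
  rewrite ltnS mdegE -[X in (_ <= X * _)%N]card_ord -sum_nat_const.
  by apply: leq_sum => i _; rewrite mnmE leq_ord.
have ltT : (#|{: 'I_d * 'X_{1..#|B| < s}}| < #|{: T1}|)%N.
  rewrite card_sig card_pffun_on card_prod !card_ord.
  apply: (@leq_ltn_trans (d * (C * t.+1) ^ #|B|)).
    rewrite leq_mul2l; apply/orP; right.
    apply: leq_trans (card_bmultinom_le _ _) _.
    case: #|B| => // k; rewrite leq_exp2r // /s /C mulSn mulnS.
    by rewrite addSn ltnS addnA leq_addl.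
  rewrite expnMn mulnA; apply: (@leq_trans (t.+1 ^ #|B|.+1)).
    by rewrite expnS ltn_pmul2r ?expn_gt0.
  by rewrite leq_pexp2l.
have spanX (a : T1) : exists c : 'I_d * 'X_{1..#|B| < s} -> K,
    vanishing I s (mfps_of_mpoly 'X_[mon a] -
      \sum_b iota (c b) * (e b.1 * mmap1 g b.2)).
  have [w [ws vw]] := approx_by_powers s (mfps_of_mpoly 'X_[mon a]).
  exists (fun b : 'I_d * 'X_{1..#|B| < s} => (w b.1)@_(b.2)).
  congr (vanishing _ _ (_ - _)): vw.
  rewrite -(pair_bigA _ (fun i m => iota (w i)@_(m : 'X_{1..#|B| < s}) *
    (e i * mmap1 g m))) /=.
  apply: eq_bigr => i _; rewrite (mmapE s (ws i)) mulr_sumr.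
  by apply: eq_bigr => m _; rewrite mulrCA.
have [l [[a0 la0] vl]] := linear_dependence (vanishing_ideal K I s) ltT spanX.
move/eqP: la0; apply.
rewrite -[RHS](vl (mon a0)) //; last exact: monI.
rewrite mfps_sum (bigD1 a0) //= big1 => [|a aa0].
  by rewrite addr0 -scalerAl mul1r mfpsZ /mfps_of_mpoly mcoeffX eqxx mulr1.
rewrite -scalerAl mul1r mfpsZ /mfps_of_mpoly mcoeffX; case: eqP => [E|]; last first.
  by rewrite mulr0.
case/eqP: aa0; apply/val_inj/ffunP => i; apply: val_inj.
by have /mnmP/(_ i) := E; rewrite !mnmE.
Qed.

End Necessity.

(** * Radical ideals *)

Section Radical.
Variables (A : comNzRingType) (J : set A).
Hypothesis idJ : is_ideal J.

Definition radical : set A := [set x | exists k, J (x ^+ k)].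

Lemma ideal_leX x k k' : (k <= k')%N -> J (x ^+ k) -> J (x ^+ k').
Proof. by move=> /subnK <- Jx; rewrite exprD; exact: (idealMl idJ). Qed.

Lemma radical_ideal : is_ideal radical.
Proof.
split=> [|x y [a xa] [b yb]|a x [k xk]].
- by exists 1%N; rewrite expr1; exact: (ideal0 idJ).
- exists (a + b)%N; rewrite exprDn; apply: (ideal_sum idJ) => i _.
  rewrite -mulr_natr; apply: (idealMr idJ); have [le|lt] := leqP b i.
    by apply/(idealMl idJ)/(ideal_leX le).
  apply/(idealMr idJ)/(ideal_leX _ xa).
  by rewrite leq_subRL ?(leq_trans (ltnW lt)) ?leq_addl // addnC leq_add2l ltnW.
- by exists k; rewrite exprMn; exact: (idealMl idJ).
Qed.

Lemma radical_sub x : J x -> radical x.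
Proof. by exists 1%N; rewrite expr1. Qed.

Lemma radical_of_exp x k : radical (x ^+ k) -> radical x.
Proof. by move=> [k']; rewrite -exprM => Jx; exists (k * k')%N. Qed.

End Radical.

(** * Relations for a system with indeterminate coefficients *)

Section GenericSystem.
Variables (K : fieldType) (n : nat) (p : 'I_n -> {mpoly K[n]}) (d : nat).
Hypothesis pd : forall j, (msize (p j) <= d)%N.

Local Notation T := ('I_n * 'X_{1..n < d.+1})%type.
Local Notation N := #|{: T}|.

Definition generic_poly (j : 'I_n) : {mpoly {mpoly K[N]}[n]} :=
  \sum_(m : 'X_{1..n < d.+1} | (m : 'X_{1..n}) \in msupp (p j))
    'X_(enum_rank (j, m)) *: 'X_[m].

Definition generic_ideal (I : {set 'I_n}) : set {mpoly {mpoly K[N]}[n]} :=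
  [set h | exists a b, h = \sum_j a j * generic_poly j +
                           \sum_(i | i \notin I) b i * 'X_i].

Lemma generic_ideal_ideal I : is_ideal (generic_ideal I).
Proof.
split.
- exists (fun=> 0), (fun=> 0).
  by rewrite !big1 ?addr0 // => i _; rewrite mul0r.
- move=> _ _ [a [b ->]] [a' [b' ->]].
  exists (fun i => a i + a' i), (fun i => b i + b' i).
  by rewrite addrACA -!big_split; congr (_ + _);
    apply: eq_bigr => i _; rewrite mulrDl.
- move=> c _ [a [b ->]]; exists (fun i => c * a i), (fun i => c * b i).
  by rewrite mulrDr !mulr_sumr; congr (_ + _);
    apply: eq_bigr => i _; rewrite mulrA.
Qed.

Lemma generic_ideal_poly I j : generic_ideal I (generic_poly j).
Proof.
exists (fun k => (k == j)%:R), (fun=> 0); rewrite [X in _ + X]big1 => [|i _].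
  rewrite (bigD1 j) //= eqxx mul1r big1 ?addr0 // => k /negPf ->.
  by rewrite mul0r.
by rewrite mul0r.
Qed.

Lemma generic_ideal_var (I : {set 'I_n}) i : i \notin I -> generic_ideal I 'X_i.
Proof.
move=> iI; exists (fun=> 0), (fun k => (k == i)%:R).
rewrite big1 => [|k _]; last by rewrite mul0r.
rewrite add0r (bigD1 i) //= eqxx mul1r big1 ?addr0 // => k /andP[_ /negPf ->].
by rewrite mul0r.
Qed.

Variable I : {set 'I_n}.

Let B := [set j : 'I_n | `[< nonzero_on I (p j) >] ]%SET.

Hypothesis leIB : (#|I| <= #|B|)%N.

(** The denominator is [u = x_I ^ d].  For [j] in [B] one monomial [mu j] of
    [p j] is supported in [I], and the equation [j] expresses [u] times its
    coefficient by the other coefficients and the variables of [I], modulo the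
    variables outside [I].  Dividing the resulting relation by the largest power
    of [x_i0] makes its constant coefficient nonzero. *)
Lemma generic_relation i0 : i0 \in I ->
  exists P M, P@_0%MM != 0 /\ generic_ideal I ((\prod_(i in I) 'X_i) ^+ M * P).
Proof.
move=> i0I; pose J := generic_ideal I; have idJ := generic_ideal_ideal I.
pose iota : {rmorphism K -> {mpoly {mpoly K[N]}[n]}} :=
  @mpolyC n {mpoly K[N]} \o @mpolyC N K.
have /boolp.choice[mu muP] j : exists m : 'X_{1..n < d.+1}, j \in B ->
    (m : 'X_{1..n}) \in msupp (p j) /\ forall i, i \notin I -> m i = 0%N.
  have [|jB] := boolP (j \in B); last by exists bm0.
  rewrite inE => /asboolP[m mp mI].
  have md : (mdeg m < d.+1)%N by rewrite ltnS ltnW // (leq_trans (msize_mdeg_lt mp)).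
  by exists (BMultinom md).
(* [Sp] indexes the coefficients that are eliminated; [y] lists the remaining
   ones together with the variables of [I], and [z] lists all the coefficients
   followed by [x_i0]. *)
pose Sp := [set (j, mu j) | j in B]%SET.
have cardSp : #|Sp| = #|B| by rewrite card_imset // => j j' [].
pose c (t : T) : {mpoly {mpoly K[N]}[n]} := ('X_(enum_rank t))%:MP.
pose G (x : T + 'I_n) : {mpoly {mpoly K[N]}[n]} :=
  match x with inl t => c t | inr i => 'X_i end.
pose Y := ((inl @: (~: Sp)) :|: (inr @: I))%SET : {set T + 'I_n}.
have cardY : (#|Y| < N.+1)%N.
  rewrite ltnS; apply: leq_trans (leq_card_setU _ _) _.
  rewrite !card_imset; [|exact: inr_inj|exact: inl_inj].
  by rewrite -(cardsC Sp) cardSp addnC leq_add2r.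
pose y (k : 'I_#|Y|) := G (enum_val k).
have GY x : x \in Y -> poly_span iota J y 1 (G x).
  move=> xY; have -> : G x = y (enum_rank_in xY x) by rewrite /y enum_rankK_in.
  exact: poly_span_var.
have cspan t : t \notin Sp -> poly_span iota J y 1 (c t).
  by move=> tS; apply: (GY (inl t)); rewrite inE imset_f // inE.
have Xspan (m : 'X_{1..n}) : (forall i, i \notin I -> m i = 0%N) ->
    poly_span iota J y (mdeg m) 'X_[m].
  move=> mI; rewrite mpolyXE_id mdegE; apply: poly_span_prod => // i.
  have [iI|/mI ->] := boolP (i \in I); last exact: poly_span1.
  have := poly_spanX idJ (m i) (GY (inr i) _); rewrite mul1n; apply.
  by rewrite inE imset_f ?orbT.
pose e := [multinom (if i \in I then d else 0%N) | i < n].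
have eI i : i \notin I -> e i = 0%N by move=> /negPf iI; rewrite mnmE iI.
have ed : (mdeg e <= n * d)%N.
  rewrite mdegE -[X in (_ <= X * _)%N]card_ord -sum_nat_const.
  by apply: leq_sum => i _; rewrite mnmE; case: ifP.
pose D := (n * d + d.+1)%N.
have uD : poly_span iota J y D 'X_[e].
  by apply: poly_spanW (Xspan _ eI); rewrite (leq_trans ed) // leq_addr.
pose z (k : 'I_N.+1) : {mpoly {mpoly K[N]}[n]} :=
  if unlift ord_max k is Some t then ('X_t)%:MP else 'X_i0.
have zD k : poly_span iota J y D ('X_[e] * z k).
  rewrite /z; case: unliftP => [t _|_]; last first.
    apply: poly_spanW (poly_spanM _ (Xspan _ eI) (GY (inr i0) _)) => //.
      by rewrite leq_add.
    by rewrite inE imset_f ?orbT.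
  rewrite -[t]enum_valK -/(c _); set x := enum_val t.
  have [|xS] := boolP (x \in Sp); last first.
    apply: poly_spanW (poly_spanM _ (Xspan _ eI) (cspan _ xS)) => //.
    by rewrite leq_add.
  case/imsetP => j jB ->; have [mup muI] := muP j jB.
  have mue : (mu j <= e)%MM.
    apply/mnm_lepP => i; rewrite mnmE; case: ifP => [_|/negbT/muI -> //].
    rewrite -ltnS; apply: leq_ltn_trans (bmdeg (mu j)).
    by rewrite mdegE (bigD1 i) ?leq_addr.
  pose r : {mpoly {mpoly K[N]}[n]} := \sum_(m : 'X_{1..n < d.+1} |
      ((m : 'X_{1..n}) \in msupp (p j)) && (m != mu j))
    'X_(enum_rank (j, m)) *: 'X_[m].
  have FE : generic_poly j = c (j, mu j) * 'X_[mu j] + r.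
    by rewrite /generic_poly (bigD1 (mu j)) //= mul_mpolyC.
  apply: (@poly_span_cong _ _ _ _ idJ _ _ _ _ (- ('X_[e - mu j] * r))).
    have -> : 'X_[e] * c (j, mu j) - - ('X_[e - mu j] * r) =
        'X_[e - mu j] * generic_poly j.
      have eE : 'X_[e] = 'X_[e - mu j] * 'X_[mu j] :> {mpoly {mpoly K[N]}[n]}.
        by rewrite -mpolyXD submK.
      by rewrite opprK FE mulrDr eE -!mulrA ['X_[mu j] * _]mulrC.
    by apply: (idealMl idJ); exact: generic_ideal_poly.
  rewrite -mulNr; apply: poly_spanM => //.
    rewrite -mulN1r -(rmorph1 iota) -rmorphN; rewrite -[(n * d)%N]add0n.
    apply: poly_spanM => //; first exact: poly_spanC.
    apply: poly_spanW (Xspan _ _); first by apply: leq_trans (mdegB _ _) ed.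
    by move=> i /eI ei; rewrite mnmBE ei.
  apply: poly_span_sum => // m /andP[mp mmu].
  have [mI|/existsNP[i /not_implyP[iI mi]]] :=
      pselect (forall i, i \notin I -> m i = 0%N).
    rewrite -mul_mpolyC; apply: (poly_spanM idJ (d := 1) (d' := d)).
      apply: (cspan (j, m)); apply/imsetP => -[j' _ [jj' mE]].
      by rewrite jj' -mE eqxx in mmu.
    by apply: poly_spanW (Xspan _ mI); rewrite -ltnS bmdeg.
  apply: poly_span0; rewrite -mul_mpolyC; apply: (idealMl idJ).
  have im : (U_(i) <= m)%MM by rewrite lep1mP; apply/eqP.
  by rewrite -(submK im) mpolyXD; apply/(idealMl idJ)/generic_ideal_var.
have [P [M [P0 PJ]]] := perron_relation idJ cardY uD zD.
have liftC r : mmap iota (fun t => z (widen_ord (leqnSn N) t)) r = r%:MP.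
  rewrite [in RHS](mpolyE r) rmorph_sum; apply: eq_bigr => m _ /=.
  rewrite -[in RHS]mul_mpolyC rmorphM /= mpolyXE_id rmorph_prod; congr (_ * _).
  apply: eq_bigr => t _; rewrite rmorphXn; congr (_ ^+ _); rewrite /z.
  case: unliftP => [t'|] /(congr1 val) /= E; last first.
    by have := ltn_ord t; rewrite E ltnn.
  by congr ('X__)%:MP; apply: val_inj; rewrite /= E /bump leqNgt ltn_ord.
(* As a polynomial in [x_i0] over the ring of the coefficients, [P] is
   [q * 'X ^+ k] with [q.[0] != 0]. *)
have [k [q]] := multiplicity_XsubC (muni P) 0.
rewrite muni_neq0 //= subr0 => q0 PE.
pose ev (r : {poly {mpoly K[N]}}) : {mpoly {mpoly K[N]}[n]} :=
  (map_poly (@mpolyC n _) r).['X_i0].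
exists (ev q), (d * M + k)%N; split.
  have -> : (ev q)@_0%MM = q.[0].
    rewrite /ev -(horner_map (mcoeff 0%MM)) /= mcoeffX mnm1_eq0.
    rewrite -map_poly_comp; congr (_.[_]); apply: map_poly_id => r _ /=.
    exact: mpolyCK.
  exact: q0.
have evP : mmap iota z P = ev q * 'X_i0 ^+ k.
  rewrite mmap_muni (eq_map_poly liftC) PE rmorphM /= map_polyXn hornerM hornerXn.
  by rewrite /z unlift_none.
have xe : 'X_[e] = (\prod_(i in I) 'X_i) ^+ d :> {mpoly {mpoly K[N]}[n]}.
  rewrite mpolyXE_id -prodrXl [RHS]big_mkcond; apply: eq_bigr => i _.
  by rewrite mnmE; case: ifP.
rewrite exprD exprM -xe (bigD1 i0) //= exprMn.
rewrite evP in PJ; set w := \prod_(i in I | _) _.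
have -> : 'X_[e] ^+ M * ('X_i0 ^+ k * w ^+ k) * ev q =
    w ^+ k * ('X_[e] ^+ M * (ev q * 'X_i0 ^+ k)).
  rewrite -[LHS]mulrA [RHS]mulrCA; congr (_ * _).
  by rewrite mulrC mulrA mulrC.
exact: (idealMl idJ).
Qed.

End GenericSystem.

(** * Sufficiency: specialization of the coefficients *)

Section Sufficiency.
Variables (K : closedFieldType) (n : nat) (p : 'I_n -> {mpoly K[n]}).
Hypothesis dimp : forall I : {set 'I_n},
  (#|I| <= #|[set j : 'I_n | `[< nonzero_on I (p j) >] ]%SET|)%N.

Lemma sufficient_system : exists f : 'I_n -> {mpoly K[n]},
  (forall j, msupp (f j) =i msupp (p j)) /\
  exists N, forall i,
    mfps_ideal (fun j => mfps_of_mpoly (f j)) (mfps_of_mpoly 'X_i ^+ N).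
Proof.
pose d := \max_j msize (p j).
have pd j : (msize (p j) <= d)%N by rewrite /d (bigD1 j) //= leq_maxl.
set T := ('I_n * 'X_{1..n < d.+1})%type; set N := #|{: T}|.
(* For empty [I] any [P] with a nonzero constant coefficient will do. *)
have /boolp.choice[P] (I : {set 'I_n}) : exists P : {mpoly {mpoly K[N]}[n]},
    P@_0%MM != 0 /\ (I != finset.set0 ->
      exists M, generic_ideal p I ((\prod_(i in I) 'X_i) ^+ M * P)).
  have [->|[i0 i0I]] := set_0Vmem I.
    by exists 1; rewrite mcoeff1 eqxx oner_neq0 eqxx.
  have [P [M [P0 PJ]]] := generic_relation pd (dimp I) i0I.
  by exists P; split=> // _; exists M.
move=> PP.
(* A nonzero of [Q] keeps the constant coefficients of the [P I] and all the
   coefficients of the system nonzero; the latter preserves the supports. *)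
pose Q : {mpoly K[N]} := (\prod_I (P I)@_0%MM) * \prod_t 'X_t.
have /exists_meval_neq0[v] : Q != 0.
  rewrite mulf_neq0 //; first by apply/prodf_neq0 => I _; case: (PP I).
  apply/prodf_neq0 => t _; rewrite -msize_poly_eq0 msizeX //.
rewrite /Q mevalM mulf_eq0 negb_or !rmorph_prod.
move=> /andP[/prodf_neq0 vP /prodf_neq0 vX].
pose f j : {mpoly K[n]} := map_mpoly (meval v) (generic_poly p d j).
exists f; split.
  move=> j m; rewrite mcoeff_msupp mcoeff_map_mpoly raddf_sum /=.
  under eq_bigr do rewrite mcoeffZ mcoeffX.
  have [mp|mp] := boolP (m \in msupp (p j)).
    have md : (mdeg m < d.+1)%N.
      by rewrite ltnS ltnW // (leq_trans (msize_mdeg_lt mp)).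
    rewrite (bigD1 (BMultinom md)) //= eqxx mulr1 big1 => [|m' /andP[_ mm']].
      rewrite addr0; exact: vX.
    by rewrite eqE /= in mm'; rewrite (negPf mm') mulr0.
  rewrite big1 ?rmorph0 ?eqxx // => m' m'p.
  case: eqP => [E|_]; last by rewrite mulr0.
  by rewrite -E m'p in mp.
pose J : set {mfps K[n]} := mfps_ideal (fun j => mfps_of_mpoly (f j)).
have idJ : is_ideal J := mfps_ideal_ideal _.
have idR := radical_ideal idJ.
pose x i : {mfps K[n]} := mfps_of_mpoly 'X_i.
have [phi [phiX phif phi0]] :
    exists phi : {rmorphism {mpoly {mpoly K[N]}[n]} -> {mfps K[n]}},
    [/\ forall i, phi 'X_i = x i,
        forall j, phi (generic_poly p d j) = mfps_of_mpoly (f j) &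
        forall h, phi h 0%MM = (h@_0%MM).@[v]].
  exists (@mfps_of_mpoly n K \o map_mpoly (meval v)); split=> [i|//|h] /=.
    by rewrite map_mpolyX.
  exact: mcoeff_map_mpoly.
have phiP I : I != finset.set0 -> exists M h b,
    J h /\ (\prod_(i in I) x i) ^+ M = h + \sum_(i | i \notin I) b i * x i.
  move=> I0; have [P0 /(_ I0)[M [a [b PE]]]] := PP I.
  have [|g gP] := @mfps_unit n K (phi (P I)).
    by rewrite phi0; apply: vP.
  exists M, (\sum_j (g * phi (a j)) * mfps_of_mpoly (f j)), (fun i => g * phi (b i)).
  split; first by exists (fun j => g * phi (a j)).
  have := congr1 (fun h => g * phi h) PE.
  rewrite rmorphM mulrCA gP mulr1 rmorphXn rmorph_prod /=.
  under eq_bigr do rewrite phiX.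
  move=> ->; rewrite rmorphD !rmorph_sum mulrDr !mulr_sumr; congr (_ + _).
    by apply: eq_bigr => j _; rewrite rmorphM phif mulrA.
  by apply: eq_bigr => i _; rewrite rmorphM phiX mulrA.
(* Multiplied by [x_I], the terms [b i * x i] with [i] outside [I] become
   multiples of [x_(i |: I)]. *)
have step (I : {set 'I_n}) : I != finset.set0 ->
    (forall i, i \notin I -> radical J (\prod_(j in i |: I) x j)) ->
    radical J (\prod_(i in I) x i).
  move=> I0 radU; have [M [h [b [Jh E]]]] := phiP I I0.
  apply: (@radical_of_exp _ _ _ M.+1); rewrite exprSr E mulrDl mulr_suml.
  apply: (idealD idR); first by apply: radical_sub; exact: (idealMr idJ).
  apply: (ideal_sum idR) => i iI; rewrite -mulrA; apply: (idealMl idR).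
  by have := radU i iI; rewrite big_setU1.
have radI k : forall I : {set 'I_n}, (#|~: I| <= k)%N -> I != finset.set0 ->
    radical J (\prod_(i in I) x i).
  elim: k => [|k IHk] I cI I0; apply: step => // i iI.
    by move: cI; rewrite leqn0 cards_eq0 => /eqP/setP/(_ i); rewrite !inE iI.
  apply: IHk; last by apply/set0Pn; exists i; rewrite !inE eqxx.
  rewrite -ltnS; apply: leq_trans cI; apply: proper_card; apply/properP; split.
    by apply/fintype.subsetP => j; rewrite !inE negb_or => /andP[].
  by exists i; rewrite !inE ?iI ?eqxx.
have /boolp.choice[k kP] i : exists k, J (x i ^+ k).
  have := radI _ (finset.set1 i) (leqnn _) _; rewrite big_set1; apply.
  by apply/set0Pn; exists i; rewrite inE.
exists (\sum_i k i)%N => i; apply: (ideal_leX idJ _ (kP i)).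
by rewrite (bigD1 i) //= leq_addr.
Qed.

End Sufficiency.

(** * Intersection multiplicities of systems and of diagrams *)

Section MultiplicityOfSystems.
Variables (R : realType) (K : fieldType) (n : nat) (f : 'I_n -> {mpoly K[n]}).

Lemma imult_eq0 : imult R f = 0%E <-> exists i, 0%MM \in msupp (f i).
Proof.
rewrite /imult codim_eq0; last exact: mfps_ideal_ideal.
split=> [[a aE]|[i fi]].
  apply: contrapT => /forallNP f0.
  have := congr1 (fun h : {mfps K[n]} => h 0%MM) aE.
  rewrite mfps1 eqxx mfps_sum big1 => [/eqP|i _]; first by rewrite oner_eq0.
  rewrite mfps_constM /mfps_of_mpoly memN_msupp_eq0 ?mulr0 //.
  by apply/negP/f0.
have [|g <-] := @mfps_unit n K (mfps_of_mpoly (f i)).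
  by rewrite /mfps_of_mpoly -mcoeff_msupp.
apply/(idealMl (mfps_ideal_ideal _)).
exact: (mfps_ideal_gen (fun j => mfps_of_mpoly (f j))).
Qed.

Lemma imult_lty_necessary : imult R f <> 0%E -> (imult R f < +oo)%E ->
  forall I : {set 'I_n},
    (#|I| <= #|[set j : 'I_n | `[< nonzero_on I (f j) >] ]%SET|)%N.
Proof.
move=> f0 /codim_lty -/(_ (mfps_ideal_ideal _))[d [e eJ]] I.
apply: card_necessary eJ _ => j; apply/negP => fj; apply: f0.
by apply/imult_eq0; exists j.
Qed.

End MultiplicityOfSystems.

Theorem corollary4p4 (K : closedFieldType) (R : realType) (n : nat)
    (n_gt0 : (0 < n)%N) (Gamma : 'I_n -> set 'rV[R]_n)
    (hGamma : forall i, is_diagram K (Gamma i)) :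
  (diagram_imult K Gamma = 0%E <-> exists i, Gamma i 0)
  /\
  (diagram_imult K Gamma <> 0%E ->
    ((diagram_imult K Gamma < +oo)%E <->
      forall I : {set 'I_n},
        (#|I| <= #|[pred j | `[< Gamma j `&` coord_subspace I !=set0 >] ]|)%N)).
Proof.
(* [f] realizes the minimum, so it serves for part (1) and for necessity; for
   sufficiency any system with the same supports bounds the minimum. *)
have [[f fG fE] fmin] := diagram_imultP hGamma; rewrite /= in fG.
have cardE (I : {set 'I_n}) :
    #|[pred j | `[< Gamma j `&` coord_subspace I !=set0 >] ]| =
    #|[set j : 'I_n | `[< nonzero_on I (f j) >] ]%SET|.
  apply: eq_card => j; rewrite !inE; apply: asbool_equiv_eq.
  by rewrite -fG; exact: newton_diagram_meets.
rewrite -fE; split.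
  rewrite imult_eq0; split=> -[i Hi]; exists i.
    by rewrite -fG; apply/newton_diagram0.
  by apply/(newton_diagram0 R); rewrite fG.
move=> f0; split=> [flty I|dimG].
  by rewrite cardE; exact: imult_lty_necessary f0 flty I.
have [|g [gf [N gN]]] := @sufficient_system K n f.
  by move=> I; rewrite -cardE.
apply: (@le_lt_trans _ _ (imult R g)).
  rewrite fE; apply: fmin; exists g => // j /=.
  by rewrite -fG; exact: newton_diagram_supp.
exact: (codim_lty_of_powers R (mfps_ideal_ideal _) gN).
Qed.
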